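(* Let $V$ be a finite set (case $q=1$) or a finite-dimensional $\mathbb{F}_q$-vector space (case $q\ge 2$ a prime power), $n=\operatorname{rk}V$. Let $k\in\{0,\ldots,n\}$ and let $I\le J\le V$ be subspaces with $i=\operatorname{rk}I$ and $j=n-\operatorname{rk}J$. Let $\mathcal{F}^{(V,k)}(I,J)=\{K\in{V\brack k}\mid I\le K\le J\}$. Then $$\deg\mathcal{F}^{(V,k)}(I,J)=\begin{cases}-\infty&\text{if }i>k\text{ or }j>n-k,\\ \min(i+j,\,k,\,n-k)&\text{otherwise.}\end{cases}$$
   Context: For $q=1$, ''subspaces'' of $V$ are subsets and $\operatorname{rk}U=\#U$; for $q\ge2$ they are $\mathbb{F}_q$-linear subspaces and $\operatorname{rk}U=\dim U$. $U\le W$ means inclusion. ${V\brack k}$ is the set of all subspaces of $V$ of rank $k$. For a subspace $U$ of $V$, $\boldsymbol{x}_U^{(k)}$ is the characteristic function of $\{K\in{V\brack k}\mid U\le K\}$. For $i\in\{0,\ldots,\min(k,n-k)\}$, $\bar V_i^{(k)}\subseteq\mathbb{R}^{{V\brack k}}$ is the real span of $\{\boldsymbol{x}_I^{(k)}\mid I\in{V\brack i}\}$; these spaces form an increasing chain with $\bar V^{(k)}_{\min(k,n-k)}=\mathbb{R}^{{V\brack k}}$. The degree of a non-zero $f:{V\brack k}\to\mathbb{R}$ is the smallest $t\in\{0,\ldots,\min(k,n-k)\}$ with $f\in\bar V_t^{(k)}$; $\deg(\boldsymbol 0)=-\infty$. The degree of a set $\mathcal{F}\subseteq{V\brack k}$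 is the degree of its characteristic function. *)

(* Defs.v *)
From HB Require Import structures.
From mathcomp Require Import all_boot all_order all_algebra all_field.
From mathcomp Require Import constructive_ereal reals.
Set Implicit Arguments.
Unset Strict Implicit.
Unset Printing Implicit Defensive.

Import GRing.Theory VectorInternalTheory.
Local Open Scope ring_scope.

(* The subtype structure of {vspace W} used by [by <:] is only declared in
   VectorInternalTheory. *)
HB.instance Definition _ (F : finFieldType) (W : vectType F) :=
  [Countable of {vspace W} by <:].
HB.instance Definition _ (F : finFieldType) (W : vectType F) :=
  [Finite of {vspace W} by <:].

(* [SetSpace T] is the case q = 1 (V is the finite set of elements of T);
   [VectSpace W] is the case q = #|F|, F being the finite field with q
   elements (V is W; a [vectType] is finite-dimensional). *)
Inductive ambient :=
  | SetSpace of finType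
  | VectSpace (F : finFieldType) of vectType F.

Definition subspace (V : ambient) : finType :=
  match V with
  | SetSpace T => {set T}
  | @VectSpace F W => {vspace W}
  end.

Definition incl (V : ambient) : rel (subspace V) :=
  match V return rel (subspace V) with
  | SetSpace T => fun U W => U \subset W
  | @VectSpace F X => fun U W => (U <= W)%VS
  end.

Definition whole (V : ambient) : subspace V :=
  match V return subspace V with
  | SetSpace T => [set: T]
  | @VectSpace F W => fullv
  end.

Definition rk (V : ambient) : subspace V -> nat :=
  match V return subspace V -> nat with
  | SetSpace T => fun U => #|U|
  | @VectSpace F W => fun U => \dim U
  end.

Definition rank (V : ambient) : nat := rk (whole V).

Definition grass (V : ambient) (k : nat) : finType :=
  {K : subspace V | rk K == k}.

(* R^o is R as a vector space over itself; it gives the space of real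
   functions its library structure of [vectType R], hence [span]. *)
Definition realfun (R : realType) (V : ambient) (k : nat) : vectType R :=
  {ffun grass V k -> R^o}.

Definition charfun (R : realType) (V : ambient) (k : nat)
    (A : {set grass V k}) : realfun R V k :=
  [ffun K => (K \in A)%:R].

Definition xvec (R : realType) (V : ambient) (k : nat) (U : subspace V) :
    realfun R V k :=
  charfun R [set K : grass V k | incl U (val K)].

Definition Vbar (R : realType) (V : ambient) (k i : nat) :
    {vspace realfun R V k} :=
  <<[seq xvec R k (val U) | U : grass V i]>>%VS.

Definition maxdeg (V : ambient) (k : nat) : nat := minn k (rank V - k)%N.

(* [find] returns the least t <= maxdeg V k with f \in Vbar R V k t; it would
   return (maxdeg V k).+1 if there were none, but there always is one when
   k <= rank V, since Vbar R V k (maxdeg V k) is then the full space. *)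
Definition degree (R : realType) (V : ambient) (k : nat) (f : realfun R V k) :
    \bar nat :=
  if f == 0 then -oo%E
  else (find (fun t => f \in Vbar R V k t) (iota 0 (maxdeg V k).+1))%:E%E.

Definition set_degree (R : realType) (V : ambient) (k : nat)
    (A : {set grass V k}) : \bar nat :=
  degree (charfun R A).

Definition family_between (V : ambient) (k : nat) (I J : subspace V) :
    {set grass V k} :=
  [set K : grass V k | incl I (val K) && incl (val K) J].

(* Main.v *)
Require Import Defs.
From mathcomp Require Import all_boot all_order all_algebra all_field.
From mathcomp Require Import constructive_ereal reals.
From mathcomp Require Import zify.

(* Let N r be the number of points (elements or vectors) of a subspace of rank
   r.  If J is a hyperplane of J', the points of J' outside J give
     chi(I,J) = chi(I,J') - (N k - N (k-1))^-1 sum_v chi(I+<v>,J'),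
   so induction on the corank of J puts chi(I,J) in Vbar_(i+j).  A singleton
   {K} is F(K,V) and also F(0,K), hence Vbar_min(k,n-k) is the full space.

   For t = min(i+j,k,n-k), a functional vanishing on Vbar_s for all s < t but
   not at chi(I,J) is f |-> sum c(rk(K :&: A)) f(K), over the K with
   E <= K <= H, where E <= A <= H have ranks k-t, k, k+t.  The numbers c are
   determined up to a scalar by vanishing on the sums over K >= U with
   rk U = k-1; they never vanish.  The chain E, A, H can be chosen so that
   rk(K :&: A) takes a single value on the K in F(I,J) between E and H. *)

Set Implicit Arguments.
Unset Strict Implicit.
Unset Printing Implicit Defensive.

(** * Points and subspaces, uniformly in sets and vector spaces *)

Section Geometry.

Import GRing.Theory.

(** All vectors count as points, 0 included, so that point counts are plain powers of q. The zero
    vector spans rank 0, but [line v] is only joined to subspaces that do not contain v. *)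
Definition point (V : ambient) : finType :=
  match V with
  | SetSpace T => T
  | @VectSpace F W => finvect_type W
  end.

Definition pts (V : ambient) : subspace V -> {set point V} :=
  match V return subspace V -> {set point V} with
  | SetSpace T => fun U => U
  | @VectSpace F W => fun U => [set v : finvect_type W | (v : W) \in U]
  end.

Definition line (V : ambient) : point V -> subspace V :=
  match V return point V -> subspace V with
  | SetSpace T => fun x => [set x]
  | @VectSpace F W => fun v => <[v : W]>%VS
  end.

Definition join (V : ambient) : subspace V -> subspace V -> subspace V :=
  match V return subspace V -> subspace V -> subspace V with
  | SetSpace T => fun U W => U :|: W
  | @VectSpace F X => fun U W => (U + W)%VS
  end.

Definition meet (V : ambient) : subspace V -> subspace V -> subspace V :=
  match V return subspace V -> subspace V -> subspace V with
  | SetSpace T => fun U W => U :&: W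
  | @VectSpace F X => fun U W => (U :&: W)%VS
  end.

Definition bottom (V : ambient) : subspace V :=
  match V return subspace V with
  | SetSpace T => set0
  | @VectSpace F W => 0%VS
  end.

Definition npts (V : ambient) (r : nat) : nat :=
  match V with
  | SetSpace T => r
  | @VectSpace F W => #|F| ^ r
  end.

Variable V : ambient.
Implicit Types (U W X : subspace V) (v : point V).

Lemma card_pts U : #|pts U| = npts V (rk U).
Proof.
(* There is no eta for structures: [finvect_type W] has the same subspaces
   as [W] only when [W] is a constructor. *)
case: V U => [T|F [W cW]] U //=.
rewrite -(@card_vspace F (finvect_type (Vector.Pack cW)) cW U).
by apply: eq_card => v; rewrite inE.
Qed.

Lemma ltn_npts r s : (npts V r < npts V s) = (r < s).
Proof. by case: V => [T|F W] //=; rewrite ltn_exp2l // finNzRing_gt1. Qed.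

Lemma incl_refl U : incl U U.
Proof. by case: V U => [T|F W] U /=. Qed.

Lemma incl_trans U W X : incl U W -> incl W X -> incl U X.
Proof. by case: V U W X => [T|F Y] U W X /=; [apply: subset_trans | apply: subv_trans]. Qed.

Lemma incl_whole U : incl U (whole V).
Proof. by case: V U => [T|F W] U /=; [apply: subsetT | apply: subvf]. Qed.

Lemma bottom_incl U : incl (bottom V) U.
Proof. by case: V U => [T|F W] U /=; [apply: sub0set | apply: sub0v]. Qed.

Lemma rk_bottom : rk (bottom V) = 0.
Proof. by case: V => [T|F W] /=; [apply: cards0 | apply: dimv0]. Qed.

Lemma incl_rk_eq U W : incl U W -> rk W <= rk U -> U = W.
Proof.
case: V U W => [T|F X] U W /= sUW leWU; apply/eqP.
  by rewrite eqEcard sUW.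
by rewrite eqEdim sUW.
Qed.

Lemma join_incl U W X : incl (join U W) X = incl U X && incl W X.
Proof. by case: V U W X => [T|F Y] U W X /=; rewrite ?subUset ?subv_add. Qed.

Lemma incl_meet U W X : incl X (meet U W) = incl X U && incl X W.
Proof. by case: V U W X => [T|F Y] U W X /=; rewrite ?subsetI ?subv_cap. Qed.

Lemma rk_join_meet U W : rk (join U W) + rk (meet U W) = rk U + rk W.
Proof.
by case: V U W => [T|F Y] U W /=; [apply: cardsUI | apply: dimv_sum_cap].
Qed.

Lemma line_incl v U : incl (line v) U = (v \in pts U).
Proof. by case: V v U => [T|F W] v U /=; rewrite ?sub1set ?inE -?memvE. Qed.

Lemma rk_line v : rk (line v) <= 1.
Proof. by case: V v => [T|F W] v /=; rewrite ?cards1 // dim_vline leq_b1. Qed.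

Lemma exists_compl U W : incl U W ->
  exists2 X, join X U = W & rk X + rk U = rk W.
Proof.
case: V U W => [T|F Y] U W /= sUW.
  exists (W :\: U); first by rewrite setUC -{1}(setIidPr sUW) setID.
  by rewrite cardsD (setIidPr sUW) subnK ?subset_leq_card.
exists (W :\: U)%VS; first by rewrite addv_diff; apply/addv_idPl.
by rewrite addnC -(dimv_cap_compl W U) (capv_idPr sUW).
Qed.


(** * Consequences that no longer distinguish the two cases *)

Lemma leq_npts r s : (npts V r <= npts V s) = (r <= s).
Proof. by rewrite leqNgt ltn_npts -leqNgt. Qed.

Lemma pts_incl U W : incl U W -> pts U \subset pts W.
Proof.
by move=> sUW; apply/subsetP=> v; rewrite -!line_incl => /incl_trans; apply.
Qed.

Lemma incl_rk U W : incl U W -> rk U <= rk W.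
Proof. by move/pts_incl/subset_leq_card; rewrite !card_pts leq_npts. Qed.

Lemma joinl U W : incl U (join U W).
Proof. by have := incl_refl (join U W); rewrite join_incl => /andP[]. Qed.

Lemma joinr U W : incl W (join U W).
Proof. by have := incl_refl (join U W); rewrite join_incl => /andP[]. Qed.

Lemma meetl U W : incl (meet U W) U.
Proof. by have := incl_refl (meet U W); rewrite incl_meet => /andP[]. Qed.

Lemma meetr U W : incl (meet U W) W.
Proof. by have := incl_refl (meet U W); rewrite incl_meet => /andP[]. Qed.

Lemma meet_id U W : incl U W -> meet U W = U.
Proof.
by move=> sUW; apply: incl_rk_eq (meetl U W) (incl_rk _); rewrite incl_meet incl_refl.
Qed.

Lemma meet_idr U W : incl W U -> meet U W = W.
Proof.
by move=> sWU; apply/esym/incl_rk_eq; rewrite ?incl_meet ?sWU ?incl_refl ?incl_rk ?meetr.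
Qed.

Lemma pts_meet U W : pts (meet U W) = pts U :&: pts W.
Proof. by apply/setP=> v; rewrite inE -!line_incl incl_meet. Qed.

Lemma rk_join_line U v : v \notin pts U -> rk (join U (line v)) = (rk U).+1.
Proof.
move=> Uv; apply/eqP; rewrite eqn_leq; apply/andP; split.
  have := rk_join_meet U (line v); have := rk_line v; lia.
rewrite ltnNge; apply: contra Uv => /(incl_rk_eq (joinl U (line v))) E.
by rewrite -line_incl E joinr.
Qed.

Lemma exists_pt U W : rk U < rk W -> exists2 v, v \in pts W & v \notin pts U.
Proof.
move=> ltUW; apply/subsetPn; apply: contraL ltUW => /subset_leq_card.
by rewrite !card_pts leq_npts -leqNgt.
Qed.

Lemma exists_between U W r : incl U W -> rk U <= r <= rk W ->
  exists X, [/\ incl U X, incl X W & rk X = r].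
Proof.
move=> sUW /andP[leUr lerW]; rewrite -(subnK leUr) in lerW *.
elim: (r - rk U) lerW => [|d IHd] ltdW; first by exists U; rewrite incl_refl.
have [X [sUX sXW rkX]] := IHd (ltnW ltdW).
have [|v Wv Xv] := @exists_pt X W; first by rewrite rkX.
exists (join X (line v)); split; last by rewrite rk_join_line // rkX.
  exact: incl_trans sUX (joinl _ _).
by rewrite join_incl sXW line_incl.
Qed.

(* The last inclusion makes join K A = join A I, hence rk (meet K A) constant,
   for all K of rank k between join I E and meet J H. *)
Lemma exists_meet_config I J k t : incl I J -> rk I <= k <= rk J ->
    t <= rk I + (rank V - rk J) -> t <= k -> t <= rank V - k ->
  exists E A H K : subspace V,
    [/\ incl E A, incl A H, incl E K & incl K H] /\
    [/\ incl I K, incl K J & incl (meet J H) (join A I)] /\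
    [/\ rk E = k - t, rk A = k, rk H = k + t & rk K = k].
Proof.
move=> sIJ /andP[leIk lekJ] le_tIJ le_tk le_tnk.
have leJn : rk J <= rank V := incl_rk (incl_whole J).
(* Rank a is taken inside I and rank b outside J. With I1 of rank a in I and J2 of corank b above J,
   choose M = A + I1 below J2 and H = M + Y, both sums direct, Y being a complement of J2. Then J
   meets H inside J2 :&: H = M, which lies in A + I. *)
have [a [b [Dt leaI lebJ]]] :
    exists a b, [/\ t = a + b, a <= rk I & b <= rank V - rk J].
  by exists (minn (rk I) t), (t - minn (rk I) t); split; lia.
subst t; clear le_tIJ.
have [|I1 [_ sI1I rkI1]] := @exists_between (bottom V) I a (bottom_incl I).
  by rewrite rk_bottom leaI.
have [|J2 [sJJ2 _ rkJ2]] := @exists_between J (whole V) (rank V - b) (incl_whole J).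
  by rewrite -/(rank V) leq_subr andbT; clear -leJn lebJ; lia.
have [|K [sIK sKJ rkK]] := @exists_between I J k sIJ; first by rewrite leIk.
have sKJ2 := incl_trans sKJ sJJ2.
have [|M [sKM sMJ2 rkM]] := @exists_between K J2 (k + a) sKJ2.
  by rewrite rkK leq_addr rkJ2; clear -le_tnk lekJ leJn; lia.
have sI1M := incl_trans sI1I (incl_trans sIK sKM).
have [A defM rkA] := exists_compl sI1M.
have {}rkA : rk A = k by clear -rkA rkM rkI1; lia.
have sAM : incl A M by rewrite -defM joinl.
have [Y defV rkY] := exists_compl (incl_whole J2).
rewrite -/(rank V) in rkY.
have Y_J2 : rk (meet Y J2) = 0.
  by have := rk_join_meet Y J2; rewrite defV -/(rank V) -rkY; clear; lia.
have M_Y : rk (meet M Y) = 0.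
  apply/eqP; rewrite -leqn0 -Y_J2 incl_rk // incl_meet meetr.
  exact: incl_trans (meetl _ _) sMJ2.
have rkH : rk (join M Y) = k + (a + b).
  have := rk_join_meet M Y; rewrite M_Y rkM.
  by clear -rkJ2 rkY lebJ leJn; lia.
have [|E [_ sEAK rkE]] :=
    @exists_between (bottom V) (meet A K) (k - (a + b)) (bottom_incl _).
  have: rk (join A K) <= rk M by rewrite incl_rk // join_incl sAM.
  have := rk_join_meet A K; rewrite rk_bottom rkA rkK rkM.
  by clear; lia.
have J2_H : meet J2 (join M Y) = M.
  apply/esym/incl_rk_eq; first by rewrite incl_meet sMJ2 joinl.
  have: rk (whole V) <= rk (join J2 (join M Y)).
    rewrite -defV incl_rk // join_incl joinl andbT.
    exact: incl_trans (joinr M Y) (joinr _ _).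
  have := rk_join_meet J2 (join M Y); rewrite -/(rank V) rkJ2 rkH rkM.
  by clear -lebJ leJn; lia.
have sMAI : incl M (join A I).
  by rewrite -defM join_incl joinl (incl_trans sI1I (joinr _ _)).
move: sEAK; rewrite incl_meet => /andP[sEA sEK].
exists E, A, (join M Y), K; split; last split; split=> //.
- exact: incl_trans sAM (joinl _ _).
- exact: incl_trans sKM (joinl _ _).
- apply: incl_trans sMAI; rewrite -[X in incl _ X]J2_H incl_meet meetr andbT.
  exact: incl_trans (meetl _ _) sJJ2.
Qed.

(** * Counting points *)

Local Open Scope ring_scope.

Lemma card_ptsD (R : pzRingType) U W :
  #|pts U :\: pts W|%:R = (npts V (rk U))%:R - (npts V (rk (meet U W)))%:R :> R.
Proof.
rewrite cardsD -pts_meet !card_pts natrB // leq_npts.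
exact/incl_rk/meetl.
Qed.

Lemma sum_join_line (R : pzRingType) (A : {set point V}) U W :
  \sum_(v in A) (incl (join U (line v)) W)%:R =
    if incl U W then #|A :&: pts W|%:R else 0 :> R.
Proof.
under eq_bigr => v _ do rewrite join_incl line_incl.
case: ifP => _ /=; last by rewrite big1.
rewrite -natr_sum -sum1_card big_mkcond [in RHS]big_mkcond /=.
congr _%:R; apply: eq_bigr => v _; rewrite inE.
by case: (v \in A); case: (v \in pts W).
Qed.

End Geometry.

(** * Upper bound on the degree *)

Section Degree.

Import GRing.Theory Num.Theory.
Local Open Scope ring_scope.

Variables (R : realType) (V : ambient) (k : nat).
Implicit Types (U W I J : subspace V) (v : point V).

Local Notation N r := ((npts V r)%:R : R).

Let scaleRE (a b : R) : a *: (b : R^o) = a * b. Proof. by []. Qed.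

Lemma npts_sub_neq0 r s : (r < s)%N -> N s - N r != 0.
Proof. by move=> ltrs; rewrite subr_eq0 eqr_nat gtn_eqF // ltn_npts. Qed.

(** Each K above U has N k - N (rk U) points outside U, so x_U is a multiple of the sum of the
    x_(U+<v>). Induction on s - rk U raises the rank up to s. *)
Lemma xvec_Vbar U s : (rk U <= s <= k)%N -> xvec R k U \in Vbar R V k s.
Proof.
move=> /andP[leUs lesk]; move Dd: (s - rk U)%N => d.
elim: d U Dd leUs => [|d IHd] U Dd leUs.
  have {leUs Dd} <- : rk U = s by lia.
  apply: memv_span; apply/imageP.
  by exists (exist (fun W => rk W == rk U) U (eqxx (rk U))).
have -> : xvec R k U =
    (N k - N (rk U))^-1 *: \sum_(v in ~: pts U) xvec R k (join U (line v)).
  apply/ffunP=> K; rewrite !ffunE sum_ffunE inE.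
  under eq_bigr => v _ do rewrite ffunE inE.
  rewrite sum_join_line; case: ifP => sUK; last by rewrite scaler0.
  rewrite setIC -setDE card_ptsD (meet_idr sUK) (eqP (valP K)).
  by rewrite scaleRE mulVf ?mulr1 // npts_sub_neq0 //; lia.
apply: rpredZ; apply: rpred_sum => v; rewrite inE => Uv.
by apply: IHd; rewrite rk_join_line //; lia.
Qed.

(** I varies in the induction: replacing J by J' lowers the corank by one, which pays for the extra
    rank of I+<v>. *)
Lemma family_Vbar I J s : incl I J -> (rk I + (rank V - rk J) <= s <= k)%N ->
  charfun R (family_between k I J) \in Vbar R V k s.
Proof.
move Dd: (rank V - rk J)%N => d.
elim: d I J Dd => [|d IHd] I J Dd sIJ les.
  have -> : J = whole V by apply: incl_rk_eq (incl_whole J) _; move: Dd; rewrite /rank; lia.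
  have -> : charfun R (family_between k I (whole V)) = xvec R k I.
    by apply/ffunP=> K; rewrite !ffunE !inE incl_whole andbT.
  by apply: xvec_Vbar; rewrite addn0 in les.
have [|J' [sJJ' _ rkJ']] := @exists_between V J (whole V) (rk J).+1 (incl_whole J).
  by move: Dd; rewrite /rank; lia.
have DdJ' : (rank V - rk J' = d)%N by rewrite rkJ'; lia.
(* A K inside J' but not inside J meets J in rank k-1, so it has N k - N (k-1) points outside J; a K
   inside J has none. The sum thus removes exactly the K not inside J. *)
have -> : charfun R (family_between k I J) = charfun R (family_between k I J')
    - (N k - N k.-1)^-1 *: \sum_(v in pts J' :\: pts J)
        charfun R (family_between k (join I (line v)) J').
  apply/ffunP=> K; rewrite !ffunE sum_ffunE !inE.
  under eq_bigr => v _ do rewrite ffunE inE.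
  have [sKJ'|nsKJ'] := boolP (incl (val K) J'); last first.
    rewrite !andbF big1 ?scaler0 ?subr0; last by move=> v _; rewrite andbF.
    have [sKJ|_] := boolP (incl (val K) J); last by rewrite andbF.
    by rewrite (incl_trans sKJ sJJ') in nsKJ'.
  under eq_bigr => v _ do rewrite andbT.
  rewrite sum_join_line; case: ifP => sIK /=; last by rewrite scaler0 subr0.
  rewrite setIC setIDA (setIidPl (pts_incl sKJ')) card_ptsD (eqP (valP K)).
  have [sKJ|nsKJ] := boolP (incl (val K) J).
    by rewrite meet_id // (eqP (valP K)) subrr scaler0 subr0.
  have lt_meet : (rk (meet (val K) J) < k)%N.
    rewrite ltnNge; apply: contra nsKJ => leK.
    by rewrite -(incl_rk_eq (meetl (val K) J)) ?meetr // (eqP (valP K)).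
  have le_join : (rk (join (val K) J) <= (rk J).+1)%N.
    by rewrite -rkJ' incl_rk // join_incl sKJ'.
  have := rk_join_meet (val K) J; rewrite (eqP (valP K)) => Ejm.
  have -> : rk (meet (val K) J) = k.-1 by lia.
  by rewrite scaleRE mulVf ?mulr1 ?subrr // npts_sub_neq0 //; lia.
apply: rpredB; first by apply: IHd => //; [apply: incl_trans sJJ' | lia].
apply: rpredZ; apply: rpred_sum => v; rewrite inE => /andP[Jv J'v].
apply: IHd => //.
  by rewrite join_incl line_incl J'v andbT; apply: incl_trans sJJ'.
rewrite rk_join_line; first lia.
by apply: contra Jv; apply/subsetP/pts_incl.
Qed.

Lemma mem_Vbar_maxdeg (f : realfun R V k) : (k <= rank V)%N ->
  f \in Vbar R V k (maxdeg V k).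
Proof.
move=> le_kn.
have -> : f = \sum_(K : grass V k) f K *: charfun R [set K].
  apply/ffunP=> K; rewrite sum_ffunE (bigD1 K) //= big1 => [|L neLK].
    by rewrite !ffunE inE eqxx addr0 scaleRE mulr1.
  by rewrite !ffunE inE eq_sym (negPf neLK) scaler0.
apply: rpred_sum => K _; apply: rpredZ.
have rkK := eqP (valP K); rewrite /maxdeg.
(* The sum i+j is k for F(K,V) and n-k for F(0,K); the smaller one is used. *)
have [le_k|lt_k] := leqP k (rank V - k).
  have -> : [set K] = family_between k (val K) (whole V).
    apply/setP=> L; rewrite !inE incl_whole andbT.
    apply/eqP/idP=> [->|sKL]; first exact: incl_refl.
    by apply/val_inj/esym/incl_rk_eq; rewrite // rkK (eqP (valP L)).
  by apply: family_Vbar; rewrite ?incl_whole // rkK; rewrite /rank; lia.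
have -> : [set K] = family_between k (bottom V) (val K).
  apply/setP=> L; rewrite !inE bottom_incl /=.
  apply/eqP/idP=> [->|sLK]; first exact: incl_refl.
  by apply/val_inj/incl_rk_eq; rewrite // rkK (eqP (valP L)).
by apply: family_Vbar; rewrite ?bottom_incl // rkK rk_bottom; lia.
Qed.

(** * Lower bound on the degree *)

(* The factor indexed by x is the ratio c_(x+1) / c_x forced by [alt_coefS].
   Starting the product at e = k - t avoids the vanishing factor at
   x = k - t - 1, where N h = N (2 * k - 1 - x) for h = k + t. *)
Definition alt_coef (e h d : nat) : R :=
  \prod_(e <= x < d) - ((N h - N (2 * k - 1 - x)) / (N (2 * k - 1 - x) - N k.-1)).

(** For rk U = k-1 and rk (U :&: A) = d, the join U+A has rank 2k-1-d. The two factors count the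
    points of U+A outside U, which raise d by one, and those of H outside U+A, which preserve it. *)
Lemma alt_coefS e h d : (e <= d < k)%N ->
  alt_coef e h d.+1 * (N (2 * k - 1 - d) - N k.-1)
    + alt_coef e h d * (N h - N (2 * k - 1 - d)) = 0.
Proof.
move=> /andP[leed ltdk]; rewrite /alt_coef big_nat_recr //= -mulrA mulNr.
by rewrite divfK ?mulrN ?addNr // npts_sub_neq0 //; lia.
Qed.

(** For k-t <= x < k the rank 2k-1-x lies strictly between k-1 and k+t, so neither numerator nor
    denominator vanishes. *)
Lemma alt_coef_neq0 t d : (k - t <= d <= k)%N -> alt_coef (k - t) (k + t) d != 0.
Proof.
move=> /andP[leed ledk]; rewrite prodf_seq_neq0; apply/allP=> x.
rewrite mem_index_iota => /andP[le_ex lt_xd] /=.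
by rewrite oppr_eq0 mulf_neq0 ?invr_eq0 // npts_sub_neq0 //; lia.
Qed.

(** * The functional vanishing on low degree *)

Section Annihilator.

Variables (t : nat) (E A H : subspace V).
Hypotheses (sEA : incl E A) (sAH : incl A H).
Hypotheses (rkE : rk E = (k - t)%N) (rkA : rk A = k) (rkH : rk H = (k + t)%N).

Let c (K : grass V k) := alt_coef (k - t) (k + t) (rk (meet (val K) A)).

(** The condition E <= K is absorbed into U: the functional takes the value [S (join U E)] at
    x_U. *)
Let S U := \sum_(K : grass V k | incl (val K) H) (incl U (val K))%:R * c K.

Let S_ext U : incl U H ->
  \sum_(v in pts H :\: pts U) S (join U (line v)) = (N k - N (rk U)) * S U.
Proof.
move=> sUH; rewrite exchange_big mulr_sumr; apply: eq_bigr => K sKH /=.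
rewrite -mulr_suml sum_join_line mulrA; congr (_ * _).
case: ifP => sUK; last by rewrite mulr0.
rewrite setIC setIDA (setIidPl (pts_incl sKH)) card_ptsD (meet_idr sUK).
by rewrite (eqP (valP K)) mulr1.
Qed.

Let S_top U : incl U H -> rk U = k ->
  S U = alt_coef (k - t) (k + t) (rk (meet U A)).
Proof.
move=> sUH /eqP rkU; pose K0 : grass V k := exist (fun W => rk W == k) U rkU.
rewrite /S (bigD1 K0) //= big1 => [|K /andP[_ neK]].
  by rewrite incl_refl mul1r addr0.
have [sUK|_] := boolP (incl U (val K)); last by rewrite mul0r.
case/eqP: neK; apply/val_inj/esym/incl_rk_eq => //=.
by rewrite (eqP rkU) (eqP (valP K)).
Qed.

(** By modularity of the rank, the meet grows exactly when adding v leaves U+A unchanged. *)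
Let rk_meet_join_line U v : rk U = k.-1 -> (0 < k)%N -> v \notin pts U ->
  rk (meet (join U (line v)) A) =
    (if v \in pts (join U A) then (rk (meet U A)).+1 else rk (meet U A)).
Proof.
move=> rkU k_gt0 Uv; have := rk_join_meet U A.
have := rk_join_meet (join U (line v)) A; rewrite rk_join_line // rkU rkA.
case: ifP => [Jv|/negbT Jv].
  have -> : join (join U (line v)) A = join U A; last by lia.
  apply: incl_rk_eq; first by rewrite !join_incl joinl joinr line_incl Jv.
  by rewrite incl_rk // join_incl joinr (incl_trans (joinl _ _) (joinl _ _)).
have -> : join (join U (line v)) A = join (join U A) (line v).
  apply: incl_rk_eq; last apply: incl_rk.
    by rewrite !join_incl joinr !(incl_trans _ (joinl (join U A) _)) ?joinl ?joinr.
  by rewrite !join_incl joinr !(incl_trans _ (joinl (join U _) _)) ?joinl ?joinr.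
by rewrite rk_join_line //; lia.
Qed.

(** Descent from rank k: by [S_ext], S U is a multiple of the sum of S over the U+<v>. Below rank
    k-1 these terms vanish by induction; at rank k-1 they are single coefficients, cancelling by
    [alt_coefS]. *)
Let S_eq0 U : incl E U -> incl U H -> (rk U < k)%N -> S U = 0.
Proof.
move Dd: (k - rk U)%N => d; elim: d U Dd => [|d IHd] U Dd sEU sUH ltUk.
  by lia.
suff: (N k - N (rk U)) * S U = 0.
  by move/eqP; rewrite mulf_eq0 (negPf (npts_sub_neq0 ltUk)) => /eqP.
rewrite -S_ext //; have [rkU|neU] := eqVneq (rk U) k.-1; last first.
  apply: big1 => v; rewrite inE => /andP[Uv Hv].
  have rkUv := rk_join_line Uv; apply: IHd; rewrite ?rkUv.
  - by move: Dd; clear; lia.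
  - exact: incl_trans sEU (joinl _ _).
  - by rewrite join_incl sUH line_incl.
  - by clear -ltUk neU; lia.
have k_gt0 : (0 < k)%N by lia.
rewrite (eq_bigr (fun v => alt_coef (k - t) (k + t)
  (if v \in pts (join U A) then (rk (meet U A)).+1 else rk (meet U A)))).
  have sJH : incl (join U A) H by rewrite join_incl sUH.
  rewrite (big_setID (pts (join U A))) /=.
  have -> : (pts H :\: pts U) :&: pts (join U A) = pts (join U A) :\: pts U.
    by rewrite setIC setIDA (setIidPl (pts_incl sJH)).
  have -> : (pts H :\: pts U) :\: pts (join U A) = pts H :\: pts (join U A).
    by rewrite setDDl (setUidPr (pts_incl (joinl U A))).
  under eq_bigr => v do [rewrite inE => /andP[_ ->]].
  under [X in _ + X]eq_bigr => v do [rewrite inE => /andP[/negPf -> _]].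
  rewrite !sumr_const -[X in X + _]mulr_natr -[X in _ + X]mulr_natr !card_ptsD (meet_idr (joinl U A)).
  rewrite (meet_idr sJH) rkU rkH.
  have rkJ : rk (join U A) = (2 * k - 1 - rk (meet U A))%N.
    by have := rk_join_meet U A; lia.
  rewrite rkJ alt_coefS //.
  (* Containing E forces rk (U :&: A) >= k-t, the range where the recurrence holds. *)
  have : (rk E <= rk (meet U A))%N by rewrite incl_rk // incl_meet sEU.
  by have := incl_rk (meetl U A); lia.
move=> v; rewrite inE => /andP[Uv Hv].
rewrite S_top ?rk_meet_join_line //; first by rewrite join_incl sUH line_incl.
by rewrite rk_join_line //; lia.
Qed.

(** On a generator x_U with rk U = s, the join U+E has rank at most s + (k-t) < k, so [S_eq0]
    applies; if U+E is not inside H, no K contributes. *)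
Lemma sum_alt_coef_Vbar (f : realfun R V k) s : (s < t <= k)%N ->
    f \in Vbar R V k s ->
  \sum_(K : grass V k | incl (val K) H)
     f K * (incl E (val K))%:R * alt_coef (k - t) (k + t) (rk (meet (val K) A)) = 0.
Proof.
move=> /andP[lt_st le_tk].
set X := [seq xvec R k (val U) | U : grass V s].
move=> fX; have /coord_span -> : f \in <<in_tuple X>>%VS by [].
under eq_bigr => K _ do rewrite sum_ffunE !mulr_suml.
rewrite exchange_big big1 //= => i _.
have /mapP[U _ ->] : (in_tuple X)`_i \in X by rewrite mem_nth.
set a := coord _ _ _.
transitivity (a * S (join (val U) E)).
  rewrite mulr_sumr; apply: eq_bigr => K _.
  by rewrite !ffunE inE join_incl scaleRE -mulnb natrM !mulrA.
have [sJH|nsJH] := boolP (incl (join (val U) E) H).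
  rewrite S_eq0 ?mulr0 ?joinr //.
  by have := rk_join_meet (val U) E; rewrite (eqP (valP U)); lia.
rewrite /S big1 ?mulr0 // => K sKH.
have [sJK|_] := boolP (incl _ _); last by rewrite mul0r.
by rewrite (incl_trans sJK sKH) in nsJH.
Qed.

End Annihilator.

(** On this family the functional is a positive number of K times one nonzero coefficient. *)
Lemma family_notin_Vbar I J s : incl I J -> (rk I <= k <= rk J)%N ->
    (s < minn (rk I + (rank V - rk J)) (minn k (rank V - k)))%N ->
  charfun R (family_between k I J) \notin Vbar R V k s.
Proof.
move=> sIJ rkIJ; set t := minn _ _ => lt_st.
have [||//|E [A [H [K0]]]] := @exists_meet_config V I J k t sIJ rkIJ.
- exact: geq_minl.
- by rewrite /t; clear; lia.
- by rewrite /t; clear; lia.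
move=> [[sEA sAH sEK0 sK0H] [[sIK0 sK0J sJH] [rkE rkA rkH rkK0]]].
(* Every relevant K satisfies K+A = A+I, and rk K = rk A = k. *)
pose d0 := (2 * k - rk (join A I))%N.
have rk_meet K : rk K = k -> incl I K -> incl K J -> incl K H -> rk (meet K A) = d0.
  move=> rkK sIK sKJ sKH; have := rk_join_meet K A; rewrite rkK rkA.
  have -> : join K A = join A I; last by rewrite /d0; clear; lia.
  apply: incl_rk_eq; last by rewrite incl_rk // join_incl joinr (incl_trans sIK) ?joinl.
  by rewrite join_incl joinl andbT (incl_trans _ sJH) // incl_meet sKJ.
apply/negP => /(@sum_alt_coef_Vbar t E A H sEA sAH rkE rkA rkH).
have -> : (s < t <= k)%N by rewrite lt_st /t; clear; lia.
move=> /(_ isT) /eqP; apply/negP.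
rewrite (eq_bigr (fun K : grass V k =>
    ((K \in family_between k I J) && incl E (val K))%:R
      * alt_coef (k - t) (k + t) d0)) => [|K sKH].
  have pK0 : rk K0 == k by apply/eqP.
  rewrite -mulr_suml -natr_sum mulf_neq0 //.
    rewrite pnatr_eq0 (bigD1 (exist (fun W => rk W == k) K0 pK0)) //=.
    by rewrite inE /= sIK0 sK0J sEK0.
  apply: alt_coef_neq0; rewrite -(rk_meet K0) // -rkE incl_rk ?incl_meet ?sEK0 //=.
  by rewrite -rkK0 incl_rk ?meetl.
rewrite ffunE inE -natrM mulnb.
have [/andP[/andP[sIK sKJ] _]|_] := boolP (_ && _); last by rewrite !mul0r.
by rewrite rk_meet // (eqP (valP K)).
Qed.

End Degree.

(** * Assembling the degree formula *)

Lemma find_iota_eq (p : pred nat) m t :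
  t < m -> p t -> (forall s, s < t -> ~~ p s) -> find p (iota 0 m) = t.
Proof.
move=> lt_tm pt np; have hasp : has p (iota 0 m).
  by apply/hasP; exists t; rewrite ?mem_iota.
have lt_fm : find p (iota 0 m) < m by rewrite -[X in _ < X](size_iota 0) -has_find.
have := nth_find 0 hasp; rewrite nth_iota // add0n => pf.
case: (ltngtP (find p (iota 0 m)) t) => // [/np|/(before_find 0)].
  by rewrite pf.
by rewrite nth_iota // add0n pt.
Qed.

Theorem theorem6p6 (R : realType) (V : ambient) (n k : nat) (I J : subspace V)
    (i j : nat)
    (hn : n = rank V) (hk : (k <= n)%N) (hIJ : incl I J)
    (hi : i = rk I) (hj : j = (n - rk J)%N) :
  set_degree R (family_between k I J) =
    if (k < i)%N || (n - k < j)%N then -oo%E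
    else (minn (i + j)%N (minn k (n - k)%N))%:E%E.
Proof.
subst n i j; have leJ : rk J <= rank V := incl_rk (incl_whole J).
rewrite /set_degree /degree.
have [empty|nonempty] := boolP (_ || _).
  rewrite (_ : charfun R _ = 0%R) ?eqxx //; apply/ffunP => K; rewrite !ffunE inE.
  have rkK := eqP (valP K).
  case: (boolP (incl I _)) => //= /incl_rk; rewrite rkK => leIk.
  case: (boolP (incl _ J)) => //= /incl_rk; rewrite rkK => lekJ.
  by move: empty; clear -leIk lekJ leJ; lia.
have rkIJ : rk I <= k <= rk J by move: nonempty; clear -leJ hk; lia.
have [K [sIK sKJ /eqP rkK]] := exists_between hIJ rkIJ.
rewrite ifF; last first.
  apply/negbTE/eqP => /ffunP /(_ (exist (fun W => rk W == k) K rkK)).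
  by rewrite !ffunE inE /= sIK sKJ => /eqP; rewrite GRing.oner_eq0.
congr (_%:E)%E; apply: find_iota_eq.
- by rewrite ltnS geq_minr.
(* If i+j exceeds min(k,n-k), the claimed degree is [maxdeg], where the span is the full space. *)
- have [le_m|/ltnW le_m] := leqP (rk I + (rank V - rk J)) (minn k (rank V - k)).
    by apply: family_Vbar; rewrite // leqnn (leq_trans le_m) ?geq_minl.
  exact: mem_Vbar_maxdeg.
- by move=> s; apply: family_notin_Vbar.
Qed.
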